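(* Let $x_1,x_2,x_3,x_4\in\mathbb{R}^3$ be the vertices of an isosceles tetrahedron, i.e. a tetrahedron in which each pair of opposite edges are equal: $r_{23}=r_{14}$, $r_{13}=r_{24}$, $r_{12}=r_{34}$. Then the Atiyah determinant $\det M_4$ of $(x_1,x_2,x_3,x_4)$ satisfies $$|\det M_4|^2\;\geq\;\prod_{\{i<j<k\}\subset\{1,2,3,4\}}\big(d_3(r_{ij},r_{ik},r_{jk})+8\,r_{ij}r_{ik}r_{jk}\big).$$
   Context: For distinct points $x_1,\dots,x_4\in\mathbb{R}^3$ let $r_{ij}=|x_i-x_j|$ and $v_{ij}=(x_j-x_i)/|x_j-x_i|$ for $i\neq j$. Put $d_3(a,b,c)=(a+b-c)(b+c-a)(c+a-b)$. Atiyah determinant: for $(a,b)\in\mathbb{C}^2$ with $|a|^2+|b|^2=1$ associate the unit vector $(2\,\mathrm{Re}(a\bar b),\,2\,\mathrm{Im}(a\bar b),\,|a|^2-|b|^2)\in S^2$ (this realizes $\mathbb{CP}^1\cong S^2$ by stereographic projection, the point of the Riemann sphere being $t=a/b$). For $i<j$ choose a unit vector $(a_{ij},b_{ij})\in\mathbb{C}^2$ associated with $v_{ij}$ and put $(a_{ji},b_{ji})=(-\overline{b_{ij}},\,\overline{a_{ij}})$, which is associated with $v_{ji}=-v_{ij}$. For $1\le i\le 4$ let $$p_i(t)=\prod_{j\neq i}(b_{ij}t-a_{ij})=\sum_{m=1}^{4}d_{im}t^{m-1},$$ a polynomial with roots $t_{ij}=a_{ij}/b_{ij}$ (a root at $\infty$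 if $b_{ij}=0$). The Atiyah determinant is $$\det M_4=\Big(\prod_{1\le i<j\le 4}2r_{ij}\Big)\det(d_{im})_{1\le i,m\le 4},$$ which does not depend on the choices of the $(a_{ij},b_{ij})$. *)

(* Defs.v *)
From mathcomp Require Import all_boot all_order all_algebra.
From mathcomp Require Import reals complex ring lra.

Set Implicit Arguments.
Unset Strict Implicit.
Unset Printing Implicit Defensive.

Import Order.TTheory GRing.Theory Num.Theory.

Local Open Scope ring_scope.
Local Open Scope complex_scope.

(* The norm that 'rV[R]_n carries in the analysis library is the sup norm,
   hence this explicit Euclidean distance. *)
Definition edist (R : realType) (n : nat) (u v : 'rV[R]_n) : R :=
  Num.sqrt (\sum_(k < n) (v 0 k - u 0 k) ^+ 2).

Definition direction (R : realType) (n : nat) (u v : 'rV[R]_n) : 'rV[R]_n :=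
  (edist u v)^-1 *: (v - u).

Definition d3 (R : realType) (a b c : R) : R :=
  (a + b - c) * (b + c - a) * (c + a - b).

(* For `|a| ^+ 2 + `|b| ^+ 2 = 1 this is the point of the unit sphere that
   corresponds to a / b on the Riemann sphere. *)
Definition sphere_point (R : realType) (a b : R[i]) : 'rV[R]_3 :=
  \row_(k < 3) [:: 2 * complex.Re (a * b^*); 2 * complex.Im (a * b^*);
                   complex.Re (`|a| ^+ 2 - `|b| ^+ 2)]`_k.

(* (a i j, b i j) are admissible homogeneous coordinates for the direction from
   x i to x j; the values a i i and b i i are irrelevant. *)
Record atiyah_choice (R : realType) (n : nat) (x : 'I_n -> 'rV[R]_3)
    (a b : 'I_n -> 'I_n -> R[i]) : Prop := AtiyahChoice {
  choice_unit : forall i j : 'I_n, (i < j)%N ->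
    `|a i j| ^+ 2 + `|b i j| ^+ 2 = 1;
  choice_direction : forall i j : 'I_n, (i < j)%N ->
    sphere_point (a i j) (b i j) = direction (x i) (x j);
  choice_antipode : forall i j : 'I_n, (i < j)%N ->
    a j i = - (b i j)^* /\ b j i = (a i j)^*
}.

Definition atiyah_poly (R : realType) (n : nat) (a b : 'I_n -> 'I_n -> R[i])
    (i : 'I_n) : {poly R[i]} :=
  \prod_(j < n | j != i) (b i j *: 'X - (a i j)%:P).

Definition atiyah_det (R : realType) (n : nat) (x : 'I_n -> 'rV[R]_3)
    (a b : 'I_n -> 'I_n -> R[i]) : R[i] :=
  (\prod_(i < n) \prod_(j < n | (i < j)%N) (2 * edist (x i) (x j)))%:C
  * \det (\matrix_(i < n, m < n) (atiyah_poly a b i)`_m).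

(* Vertices are numbered from 0. Only distinctness is required, so four
   coplanar points (the vertices of a rectangle) are allowed. *)
Definition isosceles_tetrahedron (R : realType) (x : 'I_4 -> 'rV[R]_3) : Prop :=
  let r i j := edist (x (inord i)) (x (inord j)) in
  [/\ injective x, r 1 2 = r 0 3, r 0 2 = r 1 3 & r 0 1 = r 2 3]%N.

Lemma edist_gt0 (R : realType) (n : nat) (u v : 'rV[R]_n) :
  u != v -> 0 < edist u v.
Proof.
move=> uv; rewrite sqrtr_gt0 lt_def sumr_ge0 ?andbT; last first.
  by move=> k _; exact: sqr_ge0.
apply: contra uv => /eqP s0; apply/eqP/rowP => k; apply/eqP.
have /(_ k isT) /eqP := psumr_eq0P (fun k _ => sqr_ge0 (v 0 k - u 0 k)) s0.
by rewrite sqrf_eq0 subr_eq0 eq_sym.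
Qed.

Lemma direction_unit (R : realType) (n : nat) (u v : 'rV[R]_n) :
  u != v -> \sum_(k < n) direction u v 0 k ^+ 2 = 1.
Proof.
move=> uv; have r0 := edist_gt0 uv.
under eq_bigr do rewrite !mxE exprMn.
rewrite -mulr_sumr -(@sqr_sqrtr _ (\sum_i _)) ?sumr_ge0 //; last first.
  by move=> k _; exact: sqr_ge0.
by rewrite -exprMn mulVf ?expr1n // gt_eqF.
Qed.

Lemma sphere_point_surj (R : realType) (v : 'rV[R]_3) :
  \sum_(k < 3) v 0 k ^+ 2 = 1 ->
  exists a b : R[i], `|a| ^+ 2 + `|b| ^+ 2 = 1 /\ sphere_point a b = v.
Proof.
rewrite !big_ord_recl big_ord0 addr0.
set o1 := lift _ _; set o2 := lift _ _.
set X : R := v 0 ord0; set Y : R := v 0 o1; set Z : R := v 0 o2 => sXYZ.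
have rowE (a b : R[i]) : 2 * complex.Re (a * b^*) = X ->
    2 * complex.Im (a * b^*) = Y ->
    complex.Re (`|a| ^+ 2 - `|b| ^+ 2) = Z -> sphere_point a b = v.
  move=> eX eY eZ; apply/rowP => -[[|[|[|//]]] lt_k]; rewrite mxE;
    [rewrite [LHS]eX | rewrite [LHS]eY | rewrite [LHS]eZ];
    by apply: (congr1 (v 0)); apply: val_inj.
have [Z1|Z1] := eqVneq Z (- 1).
  have XY0 : X ^+ 2 + Y ^+ 2 = 0.
    by move: sXYZ; rewrite Z1; lra.
  have /eqP := XY0; rewrite paddr_eq0 ?sqr_ge0 // !sqrf_eq0.
  move=> /andP[/eqP X0 /eqP Y0].
  exists 0, 1; split; first by rewrite normr0 normr1 expr1n exprS mul0r add0r.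
  apply: rowE; rewrite ?mul0r ?mulr0 ?X0 ?Y0 ?Z1 //.
    by rewrite normr0 normr1 expr1n exprS mul0r sub0r.
have Z2 : Z ^+ 2 <= 1 by rewrite -sXYZ addrA lerDr addr_ge0 ?sqr_ge0.
have ltZ : 0 < 1 + Z.
  rewrite -ltrBlDl sub0r lt_neqAle eq_sym Z1 /=.
  move: Z2; rewrite -(real_normK (num_real Z)) -[leRHS](expr1n _ 2).
  by rewrite ler_sqr ?nnegrE // ler_norml => /andP[].
have [q q0 q2] : exists2 q : R, 0 < q & q ^+ 2 = (1 + Z) / 2.
  exists (Num.sqrt ((1 + Z) / 2)); first by rewrite sqrtr_gt0 divr_gt0.
  by rewrite sqr_sqrtr // ltW // divr_gt0.
have qn0 : q != 0 by rewrite gt_eqF.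
have b2 : (X / (2 * q)) ^+ 2 + (Y / (2 * q)) ^+ 2 = (1 - Z) / 2.
  have -> : (X / (2 * q)) ^+ 2 + (Y / (2 * q)) ^+ 2 =
      (X ^+ 2 + Y ^+ 2) / (4 * q ^+ 2).
    by field.
  have -> : X ^+ 2 + Y ^+ 2 = (1 - Z) * (1 + Z) by lra.
  by rewrite q2; field; rewrite gt_eqF.
exists q%:C, ((X / (2 * q)) -i* (Y / (2 * q))).
have na : `|q%:C| ^+ 2 = ((1 + Z) / 2)%:C.
  rewrite normc_def /= expr0n addr0 sqrtr_sqr -rmorphXn /=.
  by rewrite real_normK ?num_real ?q2.
have nb : `|(X / (2 * q)) -i* (Y / (2 * q))| ^+ 2 = ((1 - Z) / 2)%:C.
  rewrite normc_def /= sqrrN b2 -rmorphXn /=.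
  by rewrite sqr_sqrtr // -b2 addr_ge0 ?sqr_ge0.
split; first by rewrite na nb -rmorphD /=; congr (_%:C); field.
apply: rowE; rewrite ?na ?nb /=; by field.
Qed.

Lemma atiyah_choice_exists (R : realType) (n : nat) (x : 'I_n -> 'rV[R]_3) :
  injective x -> exists a b, atiyah_choice x a b.
Proof.
move=> x_inj.
have /fin_all_exists[f fP] (ij : 'I_n * 'I_n) : exists ab : R[i] * R[i],
    (ij.1 < ij.2)%N -> `|ab.1| ^+ 2 + `|ab.2| ^+ 2 = 1 /\
    sphere_point ab.1 ab.2 = direction (x ij.1) (x ij.2).
  case: ij => i j /=; have [lt_ij|_] := ltnP i j; last by exists (0, 0).
  have xij : x i != x j.
    by apply: contraTneq lt_ij => /x_inj ->; rewrite ltnn.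
  by have [a [b abP]] := sphere_point_surj (direction_unit xij); exists (a, b).
exists (fun i j : 'I_n => if (i < j)%N then (f (i, j)).1
        else - ((f (j, i)).2)^*).
exists (fun i j : 'I_n => if (i < j)%N then (f (i, j)).2
        else ((f (j, i)).1)^*).
by split=> i j lt_ij; rewrite lt_ij ?(ltnNge j i) ?(ltnW lt_ij) //=;
  have [] := fP (i, j) lt_ij.
Qed.

(* Main.v *)
Require Import Defs.
From mathcomp Require Import all_boot all_order all_algebra.
From mathcomp Require Import reals complex.
From mathcomp Require Import ring lra.

Set Implicit Arguments.
Unset Strict Implicit.
Unset Printing Implicit Defensive.

Import Order.TTheory GRing.Theory Num.Theory.

Local Open Scope ring_scope.
Local Open Scope complex_scope.

(** In a frame formed by the axes through the midpoints of opposite edges, the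
vertices of an isosceles tetrahedron are (p, q, s), (p, -q, -s), (-p, q, -s)
and (-p, -q, s): they form one orbit of the Klein four-group of half-turns about
the axes.  This symmetry evaluates the determinant in closed form:
  |det M_4| = (2 d_3(a, b, c) + 8 a b c)^2,
where a, b, c are the three edge lengths.  All four faces have sides a, b, c, so
the claim becomes d_3(a, b, c) + 8 a b c <= 2 d_3(a, b, c) + 8 a b c, which is
the triangle inequality in the form d_3 >= 0.

The evaluation has three ingredients.

A linear substitution in the spinors (a_ij, b_ij) multiplies the determinant by
the sixth power of its own determinant ([det_linsub]), so a unitary change of
basis does not affect the modulus.  Two orthonormal vectors e1, e3 give such a
change of basis, which moves e1, e3 x e1, e3 to the coordinate axes
([rotate_spinors]); no phase has to be adjusted because only unitarity is used.

The half-turns about the coordinate axes lift to the spinor maps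
(a, b) |-> (b, a), (b, -a), (a, -b) ([klein], [bloch_klein]).  A spinor is
determined by its point of the sphere up to a phase ([bloch_phase]), so up to
phases each row of the matrix is the image of the first row
(c_0, c_1, c_2, c_3) under one of these maps, and the determinant
is 4 (c_2 c_3 - c_0 c_1)^2 ([det_cubic_klein], [det_cubic_orbit]).

Finally c_2 c_3 - c_0 c_1 is, up to a factor, the permanent of the 3 x 3 matrix
with rows (a^2 - b^2, a^2 + b^2, 2 a b) ([klein_formE]), that is, the
polarization of the cubic harmonic x y z.  The three edge directions at a vertex
are each orthogonal to one coordinate axis, so each row is a phase times an
explicit vector in the coordinates of the direction ([bloch_plane_x],
[bloch_plane_y], [bloch_plane_z]), and the permanent can be read off
([klein_form_norm]). *)

(** * Determinants of four binary cubics *)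

Section Cubics.
Variable F : comNzRingType.
Implicit Types s : F * F.

(** Coefficients of the product of the three linear forms b t - a, where a spinor
(a, b) stands for its root a / b. *)
Definition cubic_coef (s1 s2 s3 : F * F) : seq F :=
  [:: - (s1.1 * s2.1 * s3.1);
      s1.1 * s2.1 * s3.2 + s1.1 * s2.2 * s3.1 + s1.2 * s2.1 * s3.1;
      - (s1.1 * s2.2 * s3.2 + s1.2 * s2.1 * s3.2 + s1.2 * s2.2 * s3.1);
      s1.2 * s2.2 * s3.2].

(** Entries indexed by natural numbers keep the minors of such a matrix in the
same form, so that the Laplace expansion can be iterated by rewriting. *)
Definition nat_mx n (f : nat -> nat -> F) : 'M[F]_n :=
  \matrix_(i < n, j < n) f i j.

Definition cubic_mx (s : nat -> nat -> F * F) : 'M[F]_4 :=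
  nat_mx 4 (fun i m => (cubic_coef (s i 0%N) (s i 1%N) (s i 2%N))`_m).

Lemma coef_cubic s1 s2 s3 m :
  ((s1.2 *: 'X - s1.1%:P) * (s2.2 *: 'X - s2.1%:P) * (s3.2 *: 'X - s3.1%:P))`_m
  = (cubic_coef s1 s2 s3)`_m.
Proof.
have -> : (s1.2 *: 'X - s1.1%:P) * (s2.2 *: 'X - s2.1%:P) *
          (s3.2 *: 'X - s3.1%:P) = Poly (cubic_coef s1 s2 s3).
  rewrite /= !cons_poly_def /= -!mul_polyC.
  rewrite !(polyCN, polyCD, polyCM) polyC0; ring.
by rewrite coef_Poly.
Qed.

Lemma det_nat_mx n (f : nat -> nat -> F) :
  \det (nat_mx n.+1 f) = \sum_(j < n.+1)
    (-1) ^+ j * f 0 j * \det (nat_mx n (fun i k => f i.+1 (bump j k))).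
Proof.
rewrite (expand_det_row _ ord0); apply: eq_bigr => j _.
rewrite /cofactor !mxE add0n mulrA [f _ _ * _]mulrC; congr (_ * \det _).
by apply/matrixP => k l; rewrite !mxE.
Qed.

Lemma det_nat_mx4 (f : nat -> nat -> F) : \det (nat_mx 4 f) =
  f 0 0 * (f 1 1 * (f 2 2 * f 3 3 - f 2 3 * f 3 2)
         - f 1 2 * (f 2 1 * f 3 3 - f 2 3 * f 3 1)
         + f 1 3 * (f 2 1 * f 3 2 - f 2 2 * f 3 1))
- f 0 1 * (f 1 0 * (f 2 2 * f 3 3 - f 2 3 * f 3 2)
         - f 1 2 * (f 2 0 * f 3 3 - f 2 3 * f 3 0)
         + f 1 3 * (f 2 0 * f 3 2 - f 2 2 * f 3 0))
+ f 0 2 * (f 1 0 * (f 2 1 * f 3 3 - f 2 3 * f 3 1)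
         - f 1 1 * (f 2 0 * f 3 3 - f 2 3 * f 3 0)
         + f 1 3 * (f 2 0 * f 3 1 - f 2 1 * f 3 0))
- f 0 3 * (f 1 0 * (f 2 1 * f 3 2 - f 2 2 * f 3 1)
         - f 1 1 * (f 2 0 * f 3 2 - f 2 2 * f 3 0)
         + f 1 2 * (f 2 0 * f 3 1 - f 2 1 * f 3 0)) :> F.
Proof.
rewrite !(det_nat_mx, big_ord_recl, big_ord0, det_mx00) /bump /=; ring.
Qed.

Definition linsub (k l m n : F) s := (k * s.1 + l * s.2, m * s.1 + n * s.2).

(** The substitution acts on the coefficient rows through the symmetric cube of
the 2 x 2 matrix, whose determinant is the sixth power of the determinant. *)
Lemma det_linsub k l m n (s : nat -> nat -> F * F) :
  \det (cubic_mx (fun i j => linsub k l m n (s i j)))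
  = (k * n - l * m) ^+ 6 * \det (cubic_mx s).
Proof.
(* Row j: contribution of the old coefficient c_j to the new coefficients. *)
pose t (j : nat) : seq F := nth [::] [::
  [:: k ^+ 3; - (k ^+ 2 * m *+ 3); k * m ^+ 2 *+ 3; - m ^+ 3];
  [:: - (k ^+ 2 * l); k ^+ 2 * n + k * l * m *+ 2;
      - (k * m * n *+ 2 + l * m ^+ 2); m ^+ 2 * n];
  [:: k * l ^+ 2; - (k * l * n *+ 2 + l ^+ 2 * m);
      k * n ^+ 2 + l * m * n *+ 2; - (m * n ^+ 2)];
  [:: - l ^+ 3; l ^+ 2 * n *+ 3; - (l * n ^+ 2 *+ 3); n ^+ 3]] j.
have -> : cubic_mx (fun i j => linsub k l m n (s i j))
        = cubic_mx s *m nat_mx 4 (fun i j => (t i)`_j).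
  apply/matrixP => i [[|[|[|[|//]]]] ltm]; rewrite !mxE !big_ord_recl;
    rewrite big_ord0 !mxE /=; ring.
rewrite det_mulmx mulrC; congr (_ * _).
rewrite det_nat_mx4 /=.
ring.
Qed.
End Cubics.

(** * Orbits of the Klein four-group *)

Section Klein.
Variable F : comNzRingType.

(** Lifts of the half-turns about the three coordinate axes, up to phases. *)
Definition klein (i : nat) (s : F * F) : F * F :=
  nth s [:: s; (s.2, s.1); (s.2, - s.1); (s.1, - s.2)] i.

Definition klein_form (s : nat -> F * F) : F :=
  let c := cubic_coef (s 0%N) (s 1%N) (s 2%N) in c`_2 * c`_3 - c`_0 * c`_1.

(** In Sym^3 of the spinor space the monomials t^0, t^3 and t, t^2 span two
isomorphic planes for the quaternion group that lifts the Klein group, so the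
determinant of an orbit is a multiple of the square of the 2 x 2 determinant of
the components in these planes. *)
Lemma det_cubic_klein (s : nat -> F * F) :
  \det (cubic_mx (fun i k => klein i (s k))) = 4 * klein_form s ^+ 2.
Proof.
rewrite det_nat_mx4 /klein_form /=.
case: (s 0%N) (s 1%N) (s 2%N) => [a1 b1] [a2 b2] [a3 b3] /=.
ring.
Qed.

(** The vector (- A, i B, T), with A^2 + T^2 = B^2, is the null vector of a spinor.
The right-hand side is the permanent of the three vectors (A, B, T). *)
Lemma klein_formE (s : nat -> F * F) (A B T : nat -> F) :
  (forall k, A k = (s k).1 ^+ 2 - (s k).2 ^+ 2) ->
  (forall k, B k = (s k).1 ^+ 2 + (s k).2 ^+ 2) ->
  (forall k, T k = 2 * ((s k).1 * (s k).2)) ->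
  4 * klein_form s = T 0%N * (A 1%N * B 2%N + B 1%N * A 2%N)
   + T 1%N * (A 0%N * B 2%N + B 0%N * A 2%N) + T 2%N * (A 0%N * B 1%N + B 0%N * A 1%N).
Proof.
move=> hA hB hT; rewrite !hA !hB !hT /klein_form /=; ring.
Qed.

Lemma det_cubic_scale (z : nat -> nat -> F) (s : nat -> nat -> F * F) :
  \det (cubic_mx (fun i k => (z i k * (s i k).1, z i k * (s i k).2))) =
  \prod_(i < 4) \prod_(k < 3) z i k * \det (cubic_mx s).
Proof.
pose d : 'rV[F]_4 := \row_(i < 4) \prod_(k < 3) z i k.
have -> : cubic_mx (fun i k => (z i k * (s i k).1, z i k * (s i k).2)) =
    diag_mx d *m cubic_mx s.
  apply/matrixP => i [[|[|[|[|//]]]] ltm]; rewrite mul_diag_mx !mxE;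
    rewrite !big_ord_recl big_ord0 /=; ring.
by rewrite det_mulmx det_diag; congr (_ * _); apply: eq_bigr => i _; rewrite mxE.
Qed.
End Klein.

(** * Spinors and points of the sphere *)

Section Bloch.
Variable R : realType.
Implicit Types s : R[i] * R[i].

(** The rank-one matrix of the spinor s is half the sum of the identity and of
the Pauli matrix of (x, y, z): when s is a unit spinor, (x, y, z) is its point
of the sphere. *)
Record bloch s (x y z : R) : Prop := Bloch {
  bloch11 : s.1 * s.1^* = (1 + z%:C) / 2;
  bloch22 : s.2 * s.2^* = (1 - z%:C) / 2;
  bloch12 : s.1 * s.2^* = (x%:C + 'i * y%:C) / 2;
  bloch21 : s.2 * s.1^* = (x%:C - 'i * y%:C) / 2 }.

(** The Hermitian product, which is w if s' = w s for a unit spinor s. *)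
Definition phase s s' : R[i] := s'.1 * s.1^* + s'.2 * s.2^*.

Lemma bloch_phase s s' x y z : bloch s x y z -> bloch s' x y z ->
  `|phase s s'| = 1 /\ s' = (phase s s' * s.1, phase s s' * s.2).
Proof.
case: s s' => [a b] [c d] [/= h1 h2 h3 h4] [/= k1 k2 k3 k4].
rewrite /phase /=; split.
  apply/eqP; rewrite -sqrp_eq1 // normCK; apply/eqP.
  rewrite rmorphD !rmorphM /= !conjCK.
  have -> : (c * a^* + d * b^*) * (c^* * a + d^* * b) =
    (c * c^*) * (a * a^*) + (c * d^*) * (b * a^*) + (d * c^*) * (a * b^*)
     + (d * d^*) * (b * b^*) by ring.
  rewrite k1 k2 k3 k4 -h1 -h2 -h3 -h4.
  have -> : a * a^* * (a * a^*) + a * b^* * (b * a^*) + b * a^* * (a * b^*) +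
    b * b^* * (b * b^*) = (a * a^* + b * b^*) ^+ 2 by ring.
  by rewrite h1 h2; field.
have h : c * c^* + d * d^* = 1 by rewrite k1 k2; field.
congr pair.
  have -> : (c * a^* + d * b^*) * a = c * (a * a^*) + d * (a * b^*) by ring.
  rewrite h1 h3 -k1 -k3 -[LHS]mulr1 -h; ring.
have -> : (c * a^* + d * b^*) * b = c * (b * a^*) + d * (b * b^*) by ring.
rewrite h2 h4 -k2 -k4 -[LHS]mulr1 -h; ring.
Qed.

Definition turn_x i (x : R) := nth x [:: x; x; - x; - x] i.
Definition turn_y i (y : R) := nth y [:: y; - y; y; - y] i.
Definition turn_z i (z : R) := nth z [:: z; - z; - z; z] i.

Lemma bloch_klein i s x y z : bloch s x y z ->
  bloch (klein i s) (turn_x i x) (turn_y i y) (turn_z i z).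
Proof.
case: s => [a b] [/= h1 h2 h3 h4].
case: i => [|[|[|[|i]]]]; rewrite /klein /turn_x /turn_y /turn_z /= ?nth_nil;
  split => //=;
 by rewrite ?(rmorphN, mulrNN, mulrN, mulNr) /= ?(h1, h2, h3, h4); field.
Qed.

(** The null vector of a spinor is orthogonal to its point v of the sphere: it is
e - i (v x e) up to a phase, for any unit vector e orthogonal to v.  When v is
orthogonal to a coordinate axis, e can be taken along this axis, and then the
component along the axis is the phase and determines the two others. *)
Lemma bloch_plane_x s y z : bloch s 0 y z ->
  [/\ s.1 ^+ 2 + s.2 ^+ 2 = z%:C * (s.1 ^+ 2 - s.2 ^+ 2),
   2 * (s.1 * s.2) = - 'i * y%:C * (s.1 ^+ 2 - s.2 ^+ 2) &
   `|s.1 ^+ 2 - s.2 ^+ 2| = 1].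
Proof.
case: s => [a b] [/= h1 h2 h3 h4].
have n : a * a^* + b * b^* = 1 by rewrite h1 h2; field.
have o : a * b^* + b * a^* = 0 by rewrite h3 h4 rmorph0; field.
have -> : z%:C = a * a^* - b * b^* by rewrite h1 h2; field.
have e : - 'i * y%:C = b * a^* - a * b^* by rewrite h3 h4; field.
split.
- apply/eqP; rewrite -subr_eq0 -[X in X - _]mul1r -{1}n; apply/eqP.
  transitivity (2 * a * b * (a * b^* + b * a^*)); first by ring.
  by rewrite o mulr0.
- rewrite e; apply/eqP; rewrite -subr_eq0 -[X in X - _]mul1r -{1}n; apply/eqP.
  transitivity ((a ^+ 2 + b ^+ 2) * (a * b^* + b * a^*)); first by ring.
  by rewrite o mulr0.
apply/eqP; rewrite -sqrp_eq1 // normCK rmorphB !rmorphXn /=; apply/eqP.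
transitivity ((a * a^* + b * b^*) ^+ 2 - (a * b^* + b * a^*) ^+ 2); first by ring.
by rewrite n o; ring.
Qed.

Lemma bloch_plane_y s x z : bloch s x 0 z ->
  [/\ s.1 ^+ 2 - s.2 ^+ 2 = z%:C * (s.1 ^+ 2 + s.2 ^+ 2),
   2 * (s.1 * s.2) = x%:C * (s.1 ^+ 2 + s.2 ^+ 2) &
   `|s.1 ^+ 2 + s.2 ^+ 2| = 1].
Proof.
case: s => [a b] [/= h1 h2 h3 h4].
have n : a * a^* + b * b^* = 1 by rewrite h1 h2; field.
have o : a * b^* - b * a^* = 0 by rewrite h3 h4 rmorph0; field.
have -> : z%:C = a * a^* - b * b^* by rewrite h1 h2; field.
have -> : x%:C = a * b^* + b * a^* by rewrite h3 h4; field.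
split.
- apply/eqP; rewrite -subr_eq0 -[X in X - _]mul1r -{1}n; apply/eqP.
  transitivity (2 * a * b * (a * b^* - b * a^*)); first by ring.
  by rewrite o mulr0.
- apply/eqP; rewrite -subr_eq0 -[X in X - _]mul1r -{1}n; apply/eqP.
  transitivity (- (a ^+ 2 - b ^+ 2) * (a * b^* - b * a^*)); first by ring.
  by rewrite o mulr0.
apply/eqP; rewrite -sqrp_eq1 // normCK rmorphD !rmorphXn /=; apply/eqP.
transitivity ((a * a^* + b * b^*) ^+ 2 + (a * b^* - b * a^*) ^+ 2); first by ring.
by rewrite n o; ring.
Qed.

Lemma bloch_plane_z s x y : bloch s x y 0 ->
  [/\ s.1 ^+ 2 - s.2 ^+ 2 = 'i * y%:C * (2 * (s.1 * s.2)),
   s.1 ^+ 2 + s.2 ^+ 2 = x%:C * (2 * (s.1 * s.2)) &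
   `|2 * (s.1 * s.2)| = 1].
Proof.
case: s => [a b] [/= h1 h2 h3 h4].
have n : a * a^* + b * b^* = 1 by rewrite h1 h2; field.
have o : a * a^* - b * b^* = 0 by rewrite h1 h2 rmorph0; field.
have -> : 'i * y%:C = a * b^* - b * a^* by rewrite h3 h4; field.
have -> : x%:C = a * b^* + b * a^* by rewrite h3 h4; field.
split.
- apply/eqP; rewrite -subr_eq0 -[X in X - _]mul1r -{1}n; apply/eqP.
  transitivity ((a ^+ 2 + b ^+ 2) * (a * a^* - b * b^*)); first by ring.
  by rewrite o mulr0.
- apply/eqP; rewrite -subr_eq0 -[X in X - _]mul1r -{1}n; apply/eqP.
  transitivity ((a ^+ 2 - b ^+ 2) * (a * a^* - b * b^*)); first by ring.
  by rewrite o mulr0.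
apply/eqP; rewrite -sqrp_eq1 // normCK !rmorphM /= conjC_nat; apply/eqP.
transitivity ((a * a^* + b * b^*) ^+ 2 - (a * a^* - b * b^*) ^+ 2); first by ring.
by rewrite n o; ring.
Qed.

Lemma bloch_unit s x y z : bloch s x y z -> x ^+ 2 + y ^+ 2 + z ^+ 2 = 1.
Proof.
case: s => [a b] [/= h1 h2 h3 h4].
apply: (@complexI R); rewrite !rmorphD !rmorphXn rmorph1 /=.
have ii : 'i * 'i = -1 :> R[i] by rewrite -expr2 sqrCi.
have : (a * b^*) * (b * a^*) = (a * a^*) * (b * b^*) by ring.
rewrite h1 h2 h3 h4 => h; apply/eqP; rewrite -subr_eq0; apply/eqP.
transitivity (4 * ((x%:C + 'i * y%:C) / 2 * ((x%:C - 'i * y%:C) / 2) -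
  (1 + z%:C) / 2 * ((1 - z%:C) / 2)) : R[i]); first by field: ii.
by rewrite h subrr mulr0.
Qed.

(** The permanent of the three null vectors.  The equation on the coordinates
cancels its imaginary part; for edge directions at a vertex of the tetrahedron
both sides are the product p q s over the product of the edge lengths. *)
Lemma klein_form_norm (s : nat -> R[i] * R[i]) y0 z0 x1 z1 x2 y2 :
  bloch (s 0%N) 0 y0 z0 -> bloch (s 1%N) x1 0 z1 -> bloch (s 2%N) x2 y2 0 ->
  z0 * x1 * y2 = y0 * z1 * x2 ->
  `|4 * klein_form s| = `|1 + x1 * x2 + y0 * y2 + z0 * z1|%:C.
Proof.
move=> /bloch_plane_x[B0 T0 n0] /bloch_plane_y[A1 T1 n1].
move=> /bloch_plane_z[A2 B2 n2] e.
rewrite (@klein_formE _ s (fun k => (s k).1 ^+ 2 - (s k).2 ^+ 2)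
  (fun k => (s k).1 ^+ 2 + (s k).2 ^+ 2) (fun k => 2 * ((s k).1 * (s k).2))) //.
rewrite B0 T0 A1 T1 A2 B2.
set l := (_ - _) in n0 *; set m := (_ + _) in n1 *; set n := 2 * _ in n2 *.
clearbody l m n.
have ii : 'i * 'i = -1 :> R[i] by rewrite -expr2 sqrCi.
have eC : z0%:C * x1%:C * y2%:C - y0%:C * z1%:C * x2%:C = 0 :> R[i].
  by rewrite -!rmorphM e subrr.
transitivity `|l * m * n * ((1 + x1 * x2 + y0 * y2 + z0 * z1)%:C +
  'i * (z0%:C * x1%:C * y2%:C - y0%:C * z1%:C * x2%:C))|.
  by congr `|_|; rewrite !(rmorphD, rmorphM) rmorph1; ring: ii.
rewrite eC mulr0 addr0 !normrM n0 n1 n2 !mul1r.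
by rewrite normc_def /= expr0n addr0 sqrtr_sqr.
Qed.

(** If the spinors of every row have the points of those of the first row, moved
by a half-turn, then the rows form an orbit of the Klein group up to phases. *)
Lemma det_cubic_orbit (t : nat -> nat -> R[i] * R[i]) (x y z : nat -> R) :
  (forall i k, (i < 4)%N -> (k < 3)%N ->
     bloch (t i k) (turn_x i (x k)) (turn_y i (y k)) (turn_z i (z k))) ->
  `|\det (cubic_mx t)| = 4 * `|klein_form (t 0)| ^+ 2.
Proof.
move=> tP; pose w i k := phase (klein i (t 0 k)) (t i k).
have wP i k : (i < 4)%N -> (k < 3)%N -> `|w i k| = 1 /\
    t i k = (w i k * (klein i (t 0 k)).1, w i k * (klein i (t 0 k)).2).
  move=> i4 k3; apply: bloch_phase (tP i k i4 k3).
  exact: bloch_klein (tP 0 k isT k3).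
have -> : cubic_mx t = cubic_mx (fun i k => (w i k * (klein i (t 0 k)).1,
                                             w i k * (klein i (t 0 k)).2)).
  apply/matrixP => i m; rewrite !mxE.
  by rewrite -(wP i 0%N _ _).2 // -(wP i 1%N _ _).2 // -(wP i 2 _ _).2.
rewrite det_cubic_scale det_cubic_klein normrM normr_prod big1 ?mul1r.
  by rewrite normrM normrX normr_nat.
by move=> i _; rewrite normr_prod big1 // => k _; case: (wP i k _ _).
Qed.

(** * Unitary changes of frame *)

Lemma bloch_sphere_point (a b : R[i]) v : `|a| ^+ 2 + `|b| ^+ 2 = 1 ->
  sphere_point a b = v ->
  bloch (a, b) (v 0 (inord 0)) (v 0 (inord 1)) (v 0 (inord 2)).
Proof.
move=> ab <-; rewrite !mxE !inordK //=.
have ab12 : a * b^* = ((2 * complex.Re (a * b^*))%:C +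
    'i * (2 * complex.Im (a * b^*))%:C) / 2.
  by rewrite [LHS]complexE complexiE !rmorphM !rmorph_nat; field.
have zE : (complex.Re (`|a| ^+ 2 - `|b| ^+ 2))%:C = `|a| ^+ 2 - `|b| ^+ 2.
  by rewrite RRe_real // rpredB // rpredX // normr_real.
split => //=.
- by rewrite zE -{1}ab !normCK; field.
- by rewrite zE -{1}ab !normCK; field.
have -> : b * a^* = Num.conj (a * b^*) by rewrite rmorphM /= conjCK mulrC.
have J (r : R) : Num.conj r%:C = r%:C by exact: conjc_real.
by rewrite {1}ab12 !(rmorphM, rmorphD) /= !J conjCi fmorphV rmorph_nat; field.
Qed.

Let realJ (r : R) : Num.conj r%:C = r%:C. Proof. exact: conjc_real. Qed.
Let ii : 'i * 'i = -1 :> R[i]. Proof. by rewrite -expr2 sqrCi. Qed.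

Lemma bloch_intro s x y z : s.1 * s.1^* = (1 + z%:C) / 2 ->
  s.2 * s.2^* = (1 - z%:C) / 2 -> s.1 * s.2^* = (x%:C + 'i * y%:C) / 2 ->
  bloch s x y z.
Proof.
move=> h1 h2 h3; split=> //.
have -> : s.2 * s.1^* = Num.conj (s.1 * s.2^*) by rewrite rmorphM /= conjCK mulrC.
by rewrite h3 !(rmorphM, rmorphD) /= !realJ conjCi fmorphV rmorph_nat; field.
Qed.

(** Trace formula for the squared modulus of a Hermitian product. *)
Lemma bloch_overlap s s' x y z x' y' z' : bloch s x y z -> bloch s' x' y' z' ->
  let u := s'.1^* * s.1 + s'.2^* * s.2 in
  u * u^* = (1 + (x' * x + y' * y + z' * z)%:C) / 2.
Proof.
case: s s' => [a b] [c d] [/= h1 h2 h3 h4] [/= g1 g2 g3 g4].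
rewrite !(rmorphM, rmorphD) /= !conjCK.
transitivity ((c * c^*) * (a * a^*) + (d * c^*) * (a * b^*) +
    (c * d^*) * (b * a^*) + (d * d^*) * (b * b^*)); first by ring.
by rewrite g1 g2 g3 g4 h1 h2 h3 h4; field: ii.
Qed.

Section Frame.
Variables (p : R[i] * R[i]) (x1 y1 z1 x3 y3 z3 : R).
Hypotheses (p_e3 : bloch p x3 y3 z3)
  (e1_unit : x1 ^+ 2 + y1 ^+ 2 + z1 ^+ 2 = 1)
  (e1_e3 : x1 * x3 + y1 * y3 + z1 * z3 = 0).

(** The image of p under the Pauli matrix of e1 = (x1, y1, z1), which lifts the
half-turn about e1 and hence moves e3 to - e3; together with p it forms a
unitary basis. *)
Definition half_turn : R[i] * R[i] :=
  (z1%:C * p.1 + (x1%:C + 'i * y1%:C) * p.2,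
   (x1%:C - 'i * y1%:C) * p.1 - z1%:C * p.2).

Let e1C : x1%:C ^+ 2 + y1%:C ^+ 2 + z1%:C ^+ 2 - 1 = 0 :> R[i].
Proof.
apply/eqP; rewrite subr_eq0 -[X in _ == X](rmorph1 (real_complex R)) -e1_unit.
by rewrite !rmorphD !rmorphXn.
Qed.
Let e13C : x1%:C * x3%:C + y1%:C * y3%:C + z1%:C * z3%:C = 0 :> R[i].
Proof. by rewrite -!(rmorphM, rmorphD) /= e1_e3. Qed.

Lemma bloch_half_turn : bloch half_turn (- x3) (- y3) (- z3).
Proof.
rewrite /half_turn; case: p p_e3 => [a b] [/= h1 h2 h3 h4].
apply: bloch_intro; rewrite /= !(rmorphD, rmorphB, rmorphM, rmorphN) /= !realJ conjCi.
- transitivity (z1%:C ^+ 2 * (a * a^*) + z1%:C * (x1%:C - 'i * y1%:C) * (a * b^*)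
    + z1%:C * (x1%:C + 'i * y1%:C) * (b * a^*)
    + (x1%:C + 'i * y1%:C) * (x1%:C - 'i * y1%:C) * (b * b^*)); first by ring.
  rewrite h1 h2 h3 h4; apply/eqP; rewrite -subr_eq0; apply/eqP.
  transitivity (z1%:C * (x1%:C * x3%:C + y1%:C * y3%:C + z1%:C * z3%:C) +
    (1 - z3%:C) / 2 * (x1%:C ^+ 2 + y1%:C ^+ 2 + z1%:C ^+ 2 - 1) : R[i]).
    by field: ii.
  by rewrite e1C e13C !mulr0 addr0.
- transitivity (z1%:C ^+ 2 * (b * b^*) - z1%:C * (x1%:C - 'i * y1%:C) * (a * b^*)
    - z1%:C * (x1%:C + 'i * y1%:C) * (b * a^*)
    + (x1%:C + 'i * y1%:C) * (x1%:C - 'i * y1%:C) * (a * a^*)); first by ring.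
  rewrite h1 h2 h3 h4; apply/eqP; rewrite -subr_eq0; apply/eqP.
  transitivity (- z1%:C * (x1%:C * x3%:C + y1%:C * y3%:C + z1%:C * z3%:C) +
    (1 + z3%:C) / 2 * (x1%:C ^+ 2 + y1%:C ^+ 2 + z1%:C ^+ 2 - 1) : R[i]).
    by field: ii.
  by rewrite e1C e13C !mulr0 addr0.
transitivity (z1%:C * (x1%:C + 'i * y1%:C) * (a * a^*) - z1%:C ^+ 2 * (a * b^*)
    + (x1%:C + 'i * y1%:C) ^+ 2 * (b * a^*)
    - z1%:C * (x1%:C + 'i * y1%:C) * (b * b^*)); first by ring.
rewrite h1 h2 h3 h4; apply/eqP; rewrite -subr_eq0; apply/eqP.
transitivity ((x1%:C + 'i * y1%:C) * (x1%:C * x3%:C + y1%:C * y3%:C + z1%:C * z3%:C) -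
    (x3%:C + 'i * y3%:C) / 2 * (x1%:C ^+ 2 + y1%:C ^+ 2 + z1%:C ^+ 2 - 1) : R[i]).
  by field: ii.
by rewrite e1C e13C !mulr0 subr0.
Qed.

Lemma half_turn_det : `|p.1^* * half_turn.2^* - p.2^* * half_turn.1^*| = 1.
Proof.
have [h1 h2 h3 h4] := p_e3; have [g1 g2 g3 g4] := bloch_half_turn.
apply/eqP; rewrite -sqrp_eq1 // normCK; apply/eqP.
case: half_turn g1 g2 g3 g4 => [c d] /= g1 g2 g3 g4.
rewrite !(rmorphB, rmorphM) /= !conjCK.
transitivity ((p.1 * p.1^*) * (d * d^*) - (p.2 * p.1^*) * (c * d^*)
  - (p.1 * p.2^*) * (d * c^*) + (p.2 * p.2^*) * (c * c^*)); first by ring.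
rewrite {}g1 {}g2 {}g3 {}g4 !rmorphN.
transitivity ((p.1 * p.1^*) ^+ 2 + 2 * ((p.1 * p.2^*) * (p.2 * p.1^*)) +
  (p.2 * p.2^*) ^+ 2); first by rewrite h1 h2 h3 h4; field.
transitivity ((p.1 * p.1^* + p.2 * p.2^*) ^+ 2); first by ring.
by rewrite h1 h2; field.
Qed.

(** The components of a spinor in the basis p, [half_turn] are its Hermitian
products with these two spinors.  Its new coordinates come from traces of
products of Pauli matrices, and the triple product gives the middle one. *)
Lemma bloch_frame s x y z : bloch s x y z ->
  bloch (linsub p.1^* p.2^* half_turn.1^* half_turn.2^* s)
   (x1 * x + y1 * y + z1 * z)
   ((y3 * z1 - z3 * y1) * x + (z3 * x1 - x3 * z1) * y + (x3 * y1 - y3 * x1) * z)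
   (x3 * x + y3 * y + z3 * z).
Proof.
move=> sP; apply: bloch_intro.
- exact: bloch_overlap sP p_e3.
- rewrite (bloch_overlap sP bloch_half_turn) -[in RHS]rmorphN.
  by congr ((1 + _%:C) / 2); ring.
rewrite /half_turn.
case: s p p_e3 sP => [a b] [c d] [/= g1 g2 g3 g4] [/= h1 h2 h3 h4].
rewrite !(rmorphD, rmorphM, rmorphB) /= !conjCK.
transitivity (
  (z1%:C * (c * c^*) + (x1%:C + 'i * y1%:C) * (d * c^*)) * (a * a^*) +
  ((x1%:C - 'i * y1%:C) * (c * c^*) - z1%:C * (d * c^*)) * (a * b^*) +
  (z1%:C * (c * d^*) + (x1%:C + 'i * y1%:C) * (d * d^*)) * (b * a^*) +
  ((x1%:C - 'i * y1%:C) * (c * d^*) - z1%:C * (d * d^*)) * (b * b^*));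
  first by ring.
rewrite g1 g2 g3 g4 h1 h2 h3 h4; apply/eqP; rewrite -subr_eq0; apply/eqP.
transitivity ((x1%:C * x3%:C + y1%:C * y3%:C + z1%:C * z3%:C) / 2 : R[i]).
  by field: ii.
by rewrite e13C mul0r.
Qed.
End Frame.
End Bloch.

(** * Axes of an isosceles tetrahedron *)

Section Space.
Variable R : rcfType.
Implicit Types u v w : nat -> R.

Definition dot u v : R := u 0 * v 0 + u 1 * v 1 + u 2 * v 2.

Definition cross u v : nat -> R :=
  nth 0 [:: u 1 * v 2 - u 2 * v 1; u 2 * v 0 - u 0 * v 2;
            u 0 * v 1 - u 1 * v 0].

(** When one of the three vectors vanishes, which happens for a rectangle, the
cross product of the other two replaces it. *)
Lemma frame_exists u1 u2 u3 :
  dot u1 u2 = 0 -> dot u1 u3 = 0 -> dot u2 u3 = 0 ->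
  (dot u1 u1 != 0) || (dot u2 u2 != 0) ->
  (dot u1 u1 != 0) || (dot u3 u3 != 0) ->
  (dot u2 u2 != 0) || (dot u3 u3 != 0) ->
  exists e1 e3 : nat -> R,
    [/\ dot e1 e1 = 1, dot e3 e3 = 1 & dot e1 e3 = 0] /\
    [/\ dot e1 u2 = 0 /\ dot e1 u3 = 0,
        dot (cross e3 e1) u1 = 0 /\ dot (cross e3 e1) u3 = 0 &
        dot e3 u1 = 0 /\ dot e3 u2 = 0].
Proof.
move=> u12 u13 u23 n12 n13 n23.
suff [w1 [w3 [p1 p3 w13 [q1 q2] [[q3 q4] [q5 q6]]]]] : exists w1 w3 : nat -> R,
    [/\ dot w1 w1 != 0, dot w3 w3 != 0, dot w1 w3 = 0,
        dot w1 u2 = 0 /\ dot w1 u3 = 0 &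
        (dot (cross w3 w1) u1 = 0 /\ dot (cross w3 w1) u3 = 0) /\
        (dot w3 u1 = 0 /\ dot w3 u2 = 0)].
  pose n w := (Num.sqrt (dot w w))^-1.
  have nE w : dot w w != 0 -> n w ^+ 2 * dot w w = 1.
    move=> w0; rewrite /n exprVn sqr_sqrtr ?mulVf //.
    by rewrite /dot -!expr2 !addr_ge0 ?sqr_ge0.
  exists (fun k => n w1 * w1 k), (fun k => n w3 * w3 k).
  have dotZl c w v : dot (fun k => c * w k) v = c * dot w v by rewrite /dot; ring.
  have dotZr c w v : dot v (fun k => c * w k) = c * dot v w by rewrite /dot; ring.
  have cZ c d w v t : dot (cross (fun k => c * w k) (fun k => d * v k)) t
     = c * d * dot (cross w v) t by rewrite /dot /cross /=; ring.
  by rewrite !cZ !dotZl !dotZr !mulrA -!expr2 !nE // w13 q1 q2 q3 q4 q5 q6 !mulr0.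
have c3 u v w : dot (cross (cross u v) u) w = dot u u * dot v w - dot u v * dot u w.
  by rewrite /dot /cross /=; ring.
have c3' u v w : dot (cross u (cross v u)) w = dot u u * dot v w - dot v u * dot u w.
  by rewrite /dot /cross /=; ring.
have cc u v : dot (cross u v) (cross u v) = dot u u * dot v v - dot u v ^+ 2.
  by rewrite /dot /cross /=; ring.
have cl u v : dot (cross u v) u = 0 by rewrite /dot /cross /=; ring.
have cr u v : dot (cross u v) v = 0 by rewrite /dot /cross /=; ring.
have dC u v : dot u v = dot v u by rewrite /dot; ring.
have [u10|u10] := eqVneq (dot u1 u1) 0.
  rewrite u10 eqxx /= in n12 n13.
  exists (cross u2 u3), u3.
  rewrite cc !c3' cl cr u23 [dot u3 u2]dC u23 [dot u2 u1]dC u12 [dot u3 u1]dC u13.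
  by rewrite expr0n subr0 mulf_neq0 ?n12 ?n13 // !mulr0 !mul0r subr0.
have [u30|u30] := eqVneq (dot u3 u3) 0.
  rewrite u30 eqxx orbF in n23.
  exists u1, (cross u1 u2).
  rewrite cc !c3 cl cr [dot u1 (cross _ _)]dC cl u12 u13 u23 [dot u2 u1]dC u12.
  by rewrite expr0n subr0 mulf_neq0 // !mulr0 !mul0r subr0.
by exists u1, u3; rewrite !cl !cr u12 u13 [dot u3 u1]dC u13 [dot u3 u2]dC u23.
Qed.

(** The vectors u1, u2, u3 join midpoints of opposite edges, up to a factor.  Two
edges u, v of equal length satisfy (u + v) . (u - v) = 0, so the equalities of
opposite edges make u1, u2, u3 orthogonal.  The conclusion says that e1, e2,
e3 are orthogonal to u2, u3, to u1, u3 and to u1, u2. *)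
Lemma isosceles_axes (X : nat -> nat -> R) :
  let dist2 i j := dot (fun k => X j k - X i k) (fun k => X j k - X i k) in
  (forall i j, i != j -> (i < 4)%N -> (j < 4)%N -> 0 < dist2 i j) ->
  dist2 1 2 = dist2 0 3 -> dist2 0 2 = dist2 1 3 -> dist2 0 1 = dist2 2 3 ->
  exists e1 e3 : nat -> R, let e2 := cross e3 e1 in
    [/\ dot e1 e1 = 1, dot e3 e3 = 1 & dot e1 e3 = 0] /\
    [/\ dot e1 (X 1%N) = dot e1 (X 0%N) /\ dot e1 (X 3) = dot e1 (X 2),
        dot e2 (X 2) = dot e2 (X 0%N) /\ dot e2 (X 3) = dot e2 (X 1%N) &
        dot e3 (X 3) = dot e3 (X 0%N) /\ dot e3 (X 2) = dot e3 (X 1%N)].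
Proof.
move=> dist2 dist2_gt0 e12 e02 e01.
pose u1 k := X 0%N k + X 1%N k - X 2 k - X 3 k.
pose u2 k := X 0%N k + X 2 k - X 1%N k - X 3 k.
pose u3 k := X 0%N k + X 3 k - X 1%N k - X 2 k.
have u12 : dot u1 u2 = 0.
  transitivity (dist2 0%N 3 - dist2 1%N 2); last by rewrite e12 subrr.
  by rewrite /dist2 /dot /u1 /u2; ring.
have u13 : dot u1 u3 = 0.
  transitivity (dist2 0%N 2 - dist2 1%N 3); last by rewrite e02 subrr.
  by rewrite /dist2 /dot /u1 /u3; ring.
have u23 : dot u2 u3 = 0.
  transitivity (dist2 0%N 1%N - dist2 2 3); last by rewrite e01 subrr.
  by rewrite /dist2 /dot /u2 /u3; ring.
(* Two of the vectors cannot both vanish, since half their sum is an edge. *)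
have sum_neq0 u v (i : nat) : dist2 0%N i * 4 = dot u u + dot v v + 2 * dot u v ->
    dot u v = 0 -> (0 < i < 4)%N -> (dot u u != 0) || (dot v v != 0).
  move=> e uv /andP[i0 i4]; rewrite -negb_and; apply/negP => /andP[/eqP u0 /eqP v0].
  have := dist2_gt0 0%N i; rewrite neq_ltn i0 => /(_ isT isT i4).
  by rewrite -(pmulr_lgt0 _ (ltr0Sn R 3)) e u0 v0 uv mulr0 !addr0 ltxx.
have n12 := @sum_neq0 u1 u2 3.
have n13 := @sum_neq0 u1 u3 2.
have n23 := @sum_neq0 u2 u3 1.
have [|||e1 [e3 [o [[e1u2 e1u3] [e2u1 e2u3] [e3u1 e3u2]]]]] :=
  frame_exists u12 u13 u23.
- by apply: n12 => //; rewrite /dist2 /dot /u1 /u2; ring.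
- by apply: n13 => //; rewrite /dist2 /dot /u1 /u3; ring.
- by apply: n23 => //; rewrite /dist2 /dot /u2 /u3; ring.
exists e1, e3; split => //.
have dotD e v1 v2 v3 v4 : dot e (fun k => v1 k + v2 k - v3 k - v4 k) =
  dot e v1 + dot e v2 - dot e v3 - dot e v4 by rewrite /dot; ring.
rewrite !dotD in e1u2 e1u3 e2u1 e2u3 e3u1 e3u2.
by do !split; lra.
Qed.
End Space.

(** * Four vertices *)

Lemma big_pairs4 (R : comNzRingType) (F : 'I_4 -> 'I_4 -> R) :
  let G i j := F (inord i) (inord j) in
  \prod_(i < 4) \prod_(j < 4 | (i < j)%N) F i j =
  G 0 1 * G 0 2 * G 0 3 * G 1 2 * G 1 3 * G 2 3.
Proof.
move=> G; transitivity (\prod_(0 <= i < 4) \prod_(0 <= j < 4 | (i < j)%N) G i j).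
  rewrite big_mkord; apply: eq_bigr => i _; rewrite big_mkord.
  by apply: eq_bigr => j _; rewrite /G !inord_val.
rewrite /index_iota /= !(big_cons, big_nil) /=; ring.
Qed.

Lemma big_triples4 (R : comNzRingType) (F : 'I_4 -> 'I_4 -> 'I_4 -> R) :
  let G i j k := F (inord i) (inord j) (inord k) in
  \prod_(i < 4) \prod_(j < 4 | (i < j)%N) \prod_(k < 4 | (j < k)%N) F i j k =
  G 0 1 2 * G 0 1 3 * G 0 2 3 * G 1 2 3.
Proof.
move=> G; rewrite big_pairs4 /=.
have E i j : \prod_(k < 4 | ((inord j : 'I_4) < k)%N) F (inord i) (inord j) k =
    \prod_(0 <= k < 4 | ((inord j : 'I_4) < k)%N) G i j k.
  by rewrite big_mkord; apply: eq_bigr => k _; rewrite /G inord_val.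
by rewrite !E !inordK // /index_iota /= !(big_cons, big_nil) /=; ring.
Qed.

(** The bitwise exclusive or of i and k + 1.  In the numbering of the vertices by
the Klein group, the edge from i to nbr i k is the image of the edge from 0 to
k + 1 under the half-turn that moves 0 to i. *)
Definition nbr (i k : nat) : nat :=
  nth 0%N (nth [::] [:: [:: 1; 2; 3]; [:: 0; 3; 2]; [:: 3; 0; 1]; [:: 2; 1; 0]] i) k.

Lemma det_atiyah_poly (R : realType) (a b : 'I_4 -> 'I_4 -> R[i]) :
  \det (\matrix_(i < 4, m < 4) (atiyah_poly a b i)`_m) =
  \det (cubic_mx (fun i k => (a (inord i) (inord (nbr i k)),
                              b (inord i) (inord (nbr i k))))).
Proof.
congr (\det _); apply/matrixP => i m; rewrite !mxE -coef_cubic /=.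
congr ((polyseq _)`_m); rewrite /atiyah_poly.
pose g j := b i (inord j) *: 'X - (a i (inord j))%:P.
transitivity (\prod_(0 <= j < 4 | j != i :> nat) g j).
  by rewrite big_mkord; apply: eq_bigr => j _; rewrite /g inord_val.
rewrite /g inord_val /index_iota /=.
by case: i @g => [[|[|[|[|//]]]] lti] g; rewrite !(big_cons, big_nil) /nbr /=; ring.
Qed.

(** * The closed form and the inequality *)

Section Tetrahedron.
Variable R : realType.

Definition coords (x : 'rV[R]_3) (k : nat) : R := x 0 (inord k).

Lemma edist_sqr (u v : 'rV[R]_3) : edist u v ^+ 2 =
  dot (fun k => coords v k - coords u k) (fun k => coords v k - coords u k).
Proof.
rewrite /edist sqr_sqrtr; last by apply: sumr_ge0 => k _; exact: sqr_ge0.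
transitivity (\sum_(0 <= k < 3) (coords v k - coords u k) ^+ 2).
  by rewrite big_mkord; apply: eq_bigr => k _; rewrite /coords inord_val.
by rewrite /index_iota /= !big_cons big_nil /dot; ring.
Qed.

Lemma edistC (u v : 'rV[R]_3) : edist u v = edist v u.
Proof.
by rewrite /edist; congr Num.sqrt; apply: eq_bigr => k _; rewrite -sqrrN opprB.
Qed.

Lemma bloch_direction (x : 'I_4 -> 'rV[R]_3) (a b : 'I_4 -> 'I_4 -> R[i])
    (i j : 'I_4) (v : nat -> R) :
  atiyah_choice x a b -> i != j ->
  (forall k, v k = (edist (x i) (x j))^-1 * (coords (x j) k - coords (x i) k)) ->
  bloch (a i j, b i j) (v 0) (v 1) (v 2).
Proof.
move=> [cu cd ca].
wlog lt_ij : i j v / (i < j)%N => [W nij vE|_ vE].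
  case: (ltngtP i j) => [lt|lt|/val_inj e]; first exact: (W i j).
    have := W j i (fun k => - v k) lt; rewrite eq_sym nij => /(_ isT).
    have [-> ->] := ca _ _ lt.
    case=> [k|/= h1 h2 h3 h4]; first by rewrite vE edistC -mulrN opprB.
    apply: bloch_intro; rewrite /= ?rmorphN /= !conjCK.
    - by rewrite mulrNN mulrC h2 rmorphN opprK.
    - by rewrite mulrC h1 rmorphN.
    by rewrite mulNr mulrC h3 !rmorphN; field.
  by rewrite e eqxx in nij.
have := bloch_sphere_point (cu _ _ lt_ij) (cd _ _ lt_ij).
by rewrite !mxE -!vE.
Qed.

(** The second formula comes from 2 a b c + d3 a b c = a (b^2 + c^2 - a^2) + ...,
in which b^2 + c^2 - a^2 = 2 p^2. *)
Lemma face_formula (a b c p q s : R) : 0 < a -> 0 < b -> 0 < c ->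
  a ^+ 2 = q ^+ 2 + s ^+ 2 -> b ^+ 2 = p ^+ 2 + s ^+ 2 ->
  c ^+ 2 = p ^+ 2 + q ^+ 2 ->
  0 <= d3 a b c /\
  2 * d3 a b c + 8 * a * b * c =
   4 * a * b * c * (1 + p^+2 / (b * c) + q ^+ 2 / (a * c) + s ^+ 2 / (a * b)).
Proof.
move=> a0 b0 c0 ea eb ec.
have tri (u v w r : R) : 0 < u -> 0 < v -> 0 < w ->
    u ^+ 2 + v ^+ 2 - w ^+ 2 = 2 * r ^+ 2 -> 0 <= u + v - w.
  move=> u0 v0 w0 e; rewrite subr_ge0 -ler_sqr ?nnegrE ?addr_ge0 ?ltW //.
  have := sqr_ge0 r; have := mulr_gt0 u0 v0; rewrite sqrrD; lra.
split.
  rewrite /d3 !mulr_ge0 //.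
  - by apply: (tri _ _ _ s) => //; rewrite ea eb ec; ring.
  - by apply: (tri _ _ _ p) => //; rewrite ea eb ec; ring.
  - by apply: (tri _ _ _ q) => //; rewrite ea eb ec; ring.
have [an bn cn] : [/\ a != 0, b != 0 & c != 0] by rewrite !gt_eqF.
transitivity (4 * a * b * c + 4 * a * p ^+ 2 + 4 * b * q ^+ 2 + 4 * c * s ^+ 2).
  have -> : d3 a b c = a * (b ^+ 2 + c ^+ 2 - a ^+ 2) + b * (a ^+ 2 + c ^+ 2 - b ^+ 2)
     + c * (a ^+ 2 + b ^+ 2 - c ^+ 2) - 2 * a * b * c by rewrite /d3; ring.
  by rewrite ea eb ec; ring.
by field; rewrite an bn cn.
Qed.

(** Here D is the determinant of the coefficients, and its factor is the product
of the numbers 2 r_ij. *)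
Lemma face_bound (D : R[i]) (a b c p q s : R) : 0 < a -> 0 < b -> 0 < c ->
  a ^+ 2 = q ^+ 2 + s ^+ 2 -> b ^+ 2 = p ^+ 2 + s ^+ 2 ->
  c ^+ 2 = p ^+ 2 + q ^+ 2 ->
  4 * `|D| = (`|1 + p^+2 / (b * c) + q ^+ 2 / (a * c) + s ^+ 2 / (a * b)|%:C) ^+ 2 ->
  ((d3 a b c + 8 * a * b * c) ^+ 4)%:C <=
  `|((2 * a * (2 * b) * (2 * c)) ^+ 2)%:C * D| ^+ 2.
Proof.
move=> a0 b0 c0 ea eb ec.
have [d0] := face_formula a0 b0 c0 ea eb ec.
set E := (X in `|X|%:C) => dE DE.
have -> : `|((2 * a * (2 * b) * (2 * c)) ^+ 2)%:C * D| =
   ((2 * d3 a b c + 8 * a * b * c) ^+ 2)%:C.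
  rewrite normrM normc_def /= expr0n addr0 sqrtr_sqr ger0_norm ?sqr_ge0 //.
  have -> : `|D| = ((E ^+ 2 / 4))%:C.
    have n4 : (4 : R[i]) != 0 by rewrite pnatr_eq0.
    apply: (mulfI n4); rewrite DE -rmorphXn /= real_normK ?num_real //.
    by rewrite -[in RHS](rmorph_nat (real_complex R)) -rmorphM /=; congr (_%:C); field.
  by rewrite -rmorphM dE -/E /=; congr (_%:C); field.
rewrite -rmorphXn lecR -exprM.
have abc0 := mulr_gt0 (mulr_gt0 a0 b0) c0.
by apply: lerXn2r; rewrite ?nnegrE; lra.
Qed.

(** e3 is the image of a spinor p, and the basis p, [half_turn] is unitary. *)
Lemma rotate_spinors (e1 e3 : nat -> R) :
  dot e1 e1 = 1 -> dot e3 e3 = 1 -> dot e1 e3 = 0 ->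
  exists k l m n : R[i], `|k * n - l * m| = 1 /\
    forall s (v : nat -> R), bloch s (v 0%N) (v 1%N) (v 2) ->
      bloch (linsub k l m n s) (dot e1 v) (dot (cross e3 e1) v) (dot e3 v).
Proof.
move=> e11 e33 e13.
have [p p_e3] : exists p : R[i] * R[i], bloch p (e3 0%N) (e3 1%N) (e3 2).
  have v0 : forall k, (k < 3)%N -> (\row_(k < 3) e3 k) 0 (inord k) = e3 k.
    by move=> k k3; rewrite mxE inordK.
  have [|c [d [cd sp]]] := @sphere_point_surj R (\row_(k < 3) e3 k).
    by rewrite -e33 !big_ord_recl big_ord0 !mxE /dot /=; ring.
  by exists (c, d); have := bloch_sphere_point cd sp; rewrite !v0.
have e1_unit : e1 0%N ^+ 2 + e1 1%N ^+ 2 + e1 2 ^+ 2 = 1 by rewrite -e11 /dot; ring.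
pose h := half_turn p (e1 0%N) (e1 1%N) (e1 2).
exists (p.1^*), (p.2^*), (h.1^*), (h.2^*); split.
  exact: half_turn_det p_e3 e1_unit e13.
by move=> s v /(bloch_frame p_e3 e1_unit e13).
Qed.
End Tetrahedron.

Theorem mainTheorem3 (R : realType) (x : 'I_4 -> 'rV[R]_3)
    (a b : 'I_4 -> 'I_4 -> R[i]) :
  isosceles_tetrahedron x ->
  atiyah_choice x a b ->
  let r i j := edist (x i) (x j) in
  (\prod_(i < 4) \prod_(j < 4 | (i < j)%N) \prod_(k < 4 | (j < k)%N)
     (d3 (r i j) (r i k) (r j k) + 8 * r i j * r i k * r j k))%:C
  <= `|atiyah_det x a b| ^+ 2.
Proof.
move=> iso ab /=; pose r i j := edist (x (inord i)) (x (inord j)).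
have [x_inj e12 e02 e01] : [/\ injective x, r 1 2 = r 0 3,
  r 0 2 = r 1 3 & r 0 1 = r 2 3]%N := iso.
have rC i j : r i j = r j i by exact: edistC.
have r_gt0 i j : i != j -> (i < 4)%N -> (j < 4)%N -> 0 < r i j.
  move=> nij i4 j4; apply: edist_gt0; apply: contra nij => /eqP /x_inj e.
  by rewrite -(inordK i4) -(inordK j4) e.
pose X i : nat -> R := coords (x (inord i)).
have [||||e1 [e3 [[e11 e33 e13] [[E11 E13] [E22 E23] [E33 E32]]]]] :=
  @isosceles_axes R X; try by rewrite -!edist_sqr -/(r _ _) ?e12 ?e02 ?e01.
  by move=> i j nij i4 j4; rewrite -edist_sqr exprn_gt0 // r_gt0.
set e2 := cross e3 e1 in E22 E23.
have [k [l [m [n [klmn1 frame]]]]] := rotate_spinors e11 e33 e13.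
pose s i k : R[i] * R[i] :=
  (a (inord i) (inord (nbr i k)), b (inord i) (inord (nbr i k))).
pose t i j := linsub k l m n (s i j).
pose f e i j := (r i (nbr i j))^-1 * (dot e (X (nbr i j)) - dot e (X i)).
have tP i j : (i < 4)%N -> (j < 3)%N ->
    bloch (t i j) (f e1 i j) (f e2 i j) (f e3 i j).
  move=> i4 j3; pose v c := (r i (nbr i j))^-1 * (X (nbr i j) c - X i c).
  have [n4 ni] : (nbr i j < 4)%N /\ nbr i j != i.
    by case: i i4 {v} j j3 => [|[|[|[|//]]]] _ [|[|[|//]]].
  have dotv e : dot e v = f e i j by rewrite /f /v /dot; ring.
  rewrite -!dotv; apply: frame; apply: bloch_direction ab _ _ => //.
  by apply: contra ni => /eqP e; rewrite -(inordK n4) -e inordK.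
(* The directions at vertex i are those at vertex 0, moved by a half-turn. *)
have {}tP i j : (i < 4)%N -> (j < 3)%N -> bloch (t i j)
    (turn_x i (f e1 0%N j)) (turn_y i (f e2 0%N j)) (turn_z i (f e3 0%N j)).
  move=> i4 j3; have := tP i j i4 j3; congr bloch;
  case: i i4 j j3 => [|[|[|[|//]]]] _ [|[|[|//]]] _;
  rewrite /f /nbr /turn_x /turn_y /turn_z /=;
  rewrite ?E11 ?E13 ?E22 ?E23 ?E33 ?E32 ?(rC 1 0)%N ?(rC 2 0)%N ?(rC 3 0)%N
    ?(rC 3 1)%N ?(rC 2 1)%N ?(rC 3 2)%N -?e01 -?e02 ?e12; ring.
have dets : `|\det (cubic_mx s)| = `|\det (cubic_mx t)|.
  by rewrite det_linsub normrM normrX klmn1 expr1n mul1r.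
have [t0 t1 t2] := And3 (tP 0 0 isT isT)%N (tP 0 1 isT isT)%N (tP 0 2 isT isT)%N.
move: t0 t1 t2; rewrite /turn_x /turn_y /turn_z /f /nbr /=.
rewrite E11 E13 E22 E23 E33 E32 !subrr !mulr0.
set A := r 0 1; set B := r 0 2; set C := r 0 3.
set P := dot e1 (X 2) - dot e1 (X 0%N).
set Q := dot e2 (X 1%N) - dot e2 (X 0%N).
set S := dot e3 (X 1%N) - dot e3 (X 0%N).
move=> t0 t1 t2.
have [A0 B0 C0] : [/\ 0 < A, 0 < B & 0 < C] by rewrite !r_gt0.
have [An Bn Cn] : [/\ A != 0, B != 0 & C != 0] by rewrite !gt_eqF.
have eA : A ^+ 2 = Q ^+ 2 + S ^+ 2.
  by rewrite -[LHS]mulr1 -(bloch_unit t0); field.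
have eB : B ^+ 2 = P ^+ 2 + S ^+ 2.
  by rewrite -[LHS]mulr1 -(bloch_unit t1); field.
have eC : C ^+ 2 = P ^+ 2 + Q ^+ 2.
  by rewrite -[LHS]mulr1 -(bloch_unit t2); field.
rewrite big_triples4 /atiyah_det big_pairs4 det_atiyah_poly.
rewrite -/(r 0 1) -/(r 0 2) -/(r 0 3) -/(r 1 2) -/(r 1 3) -/(r 2 3).
rewrite e12 -e02 -e01 -/A -/B -/C.
have -> : (d3 A B C + 8 * A * B * C) * (d3 A C B + 8 * A * C * B) *
  (d3 B C A + 8 * B * C * A) * (d3 C B A + 8 * C * B * A) =
  (d3 A B C + 8 * A * B * C) ^+ 4 by rewrite /d3; ring.
have -> : 2 * A * (2 * B) * (2 * C) * (2 * C) * (2 * B) * (2 * A) =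
  (2 * A * (2 * B) * (2 * C)) ^+ 2 by ring.
apply: face_bound eA eB eC _ => //.
rewrite -/s dets (det_cubic_orbit tP).
have -> : P ^+ 2 / (B * C) = (B^-1 * P) * (C^-1 * P) by field; rewrite Bn Cn.
have -> : Q ^+ 2 / (A * C) = (A^-1 * Q) * (C^-1 * Q) by field; rewrite An Cn.
have -> : S ^+ 2 / (A * B) = (A^-1 * S) * (B^-1 * S) by field; rewrite An Bn.
rewrite -(klein_form_norm t0 t1 t2); last by ring.
by rewrite normrM normr_nat; ring.
Qed.
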